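(* For all integers $n\ge 2$ and $k\ge 2$, with $m=\lceil n/k\rceil$, $$\max\big\{0,\ \min\{p(n),\,2m-3\}\big\}\ \le\ \widehat{\Phi}_k(n)\ \le\ \min\Big\{\max(0,2m-3),\ f\big(\tfrac{n}{q(n,k)}\big)\Big\}.$$
   Context: For an integer $n\ge 2$, $\mathbb{Z}_n$ denotes the additive cyclic group of integers modulo $n$. For $A\subseteq\mathbb{Z}_n$ the restricted self-sumset is $A\widehat{+}A=\{a+a' : a,a'\in A,\ a\ne a'\}\subseteq\mathbb{Z}_n$ (so it is empty, of size $0$, when $|A|\le 1$). A $k$-coloring of $\mathbb{Z}_n$ is a disjoint union $\mathbb{Z}_n=A_1\sqcup\cdots\sqcup A_k$, with color classes $A_i$ (which may be empty). Define $$\widehat{\Phi}_k(n)=\min_{\mathbb{Z}_n=A_1\sqcup\cdots\sqcup A_k}\ \max_{1\le i\le k}|A_i\widehat{+}A_i|,$$ the minimum being over all $k$-colorings of $\mathbb{Z}_n$. For an integer $r\ge 2$, $p(r)$ is the least prime divisor of $r$. $q(n,k)$ is the largest (positive) divisor of $n$ that is at most $k$. The function $f$ on positive integers is $f(1)=0$, $f(2)=1$, and $f(t)=t$ for $t\ge 3$. *)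

(* Defs.v *)
From mathcomp Require Import all_boot all_order all_algebra.
Set Implicit Arguments.
Unset Strict Implicit.
Unset Printing Implicit Defensive.
Import GRing.Theory.

Definition restricted_sumset (T : finZmodType) (A : {set T}) : {set T} :=
  [set (a + a')%R | a in A, a' in A & a != a'].

Definition color_class (T : finType) (k : nat) (c : {ffun T -> 'I_k})
    (i : 'I_k) : {set T} :=
  [set x | c x == i].

Definition max_restricted_sumset (T : finZmodType) (k : nat)
    (c : {ffun T -> 'I_k}) : nat :=
  \max_(i < k) #|restricted_sumset (color_class c i)|.

(* 'Z_n is the ring of integers modulo n only when 1 < n.
   The neutral element #|'Z_n| of the minimum bounds the size of every
   restricted sumset, so for 0 < k this is the true minimum over colorings:
   see Phi_hat_le and Phi_hat_attained. *)
Definition Phi_hat (k n : nat) : nat :=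
  \big[minn/#|'Z_n|]_(c : {ffun 'Z_n -> 'I_k}) max_restricted_sumset c.

Lemma Phi_hat_le (k n : nat) (c : {ffun 'Z_n -> 'I_k}) :
  Phi_hat k n <= max_restricted_sumset c.
Proof.
rewrite /Phi_hat; have : c \in index_enum {ffun 'Z_n -> 'I_k}.
  exact: mem_index_enum.
elim: (index_enum _) => // c' s IHs; rewrite inE big_cons geq_min.
by case/predU1P => [<-|/IHs ->]; rewrite ?leqnn ?orbT.
Qed.

Lemma Phi_hat_attained (k n : nat) : 0 < k ->
  exists c : {ffun 'Z_n -> 'I_k}, Phi_hat k n = max_restricted_sumset c.
Proof.
move=> k_gt0; pose c0 : {ffun 'Z_n -> 'I_k} := [ffun=> Ordinal k_gt0].
have : Phi_hat k n = #|'Z_n| \/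
    exists c : {ffun 'Z_n -> 'I_k}, Phi_hat k n = max_restricted_sumset c.
  rewrite /Phi_hat; elim: (index_enum _) => [|c s IHs].
    by rewrite big_nil; left.
  rewrite big_cons; case: leqP => _; last exact: IHs.
  by right; exists c.
case=> // PhiE; exists c0; apply/eqP; rewrite eqn_leq Phi_hat_le /= PhiE.
by apply/bigmax_leqP => i _; apply: max_card.
Qed.

Definition largest_divisor_le (n k : nat) : nat :=
  \max_(d <- divisors n | d <= k) d.

(* The value at 0 is junk. *)
Definition f (t : nat) : nat :=
  match t with
  | 1 => 0
  | 2 => 1
  | _ => t
  end.

(* Main.v *)
(* The lower bound is Karolyi's theorem for cyclic groups: a subset A of a finite
   abelian group G has at least min(p, 2|A| - 3) restricted sums, p being the
   least prime divisor of |G|; it is applied to a class with at least n / k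
   elements. For |G| prime this is the polynomial method. In general, take H of
   order p and induct on G / H. If A meets s cosets of H, k being the largest
   intersection, then Cauchy-Davenport in G bounds the sums of the largest part
   with each of the others, the prime case in H bounds its restricted sums with
   itself, and Cauchy-Davenport in G / H provides at least s - 1 further cosets,
   nearly all of which contain a sum. This is enough as soon as k > 1, and if
   k = 1 then A embeds in G / H. The upper bounds come from colouring by
   intervals of length m and by residues modulo q(n, k). *)
Require Import Defs.
From mathcomp Require Import all_boot all_order all_algebra.
From mathcomp Require Import all_fingroup all_solvable.
From mathcomp Require Import zify ring.
Import Order.TTheory GRing.Theory Num.Theory.
Set Implicit Arguments.
Unset Strict Implicit.

(** * Polynomial method over a finite field *)

Local Open Scope ring_scope.

(* The functional [G |-> sum of w a * G a] reads off the coefficient of degree n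
   on polynomials of degree at most n, which makes the Combinatorial
   Nullstellensatz a direct computation. *)
Lemma exists_moment_weights (F : finFieldType) (A : {set F}) (n : nat) :
  #|A| = n.+1 ->
  exists w : F -> F, forall j, (j <= n)%N ->
    \sum_(a in A) w a * a ^+ j = (j == n)%:R.
Proof.
move=> cA; have sA : size (enum A) = n.+1 by rewrite -cardE.
pose a : 'rV[F]_n.+1 := \row_i (enum A)`_i.
pose V := Vandermonde n.+1 a.
have uV : V \in unitmx.
  rewrite unitmxE det_Vandermonde unitfE; apply/prodf_neq0 => i _.
  apply/prodf_neq0 => j ltij; rewrite !mxE subr_eq0 nth_uniq ?sA ?enum_uniq //.
  by rewrite neq_ltn ltij orbT.
have [v vE] : exists v : 'cV_n.+1, V *m v = delta_mx ord_max 0.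
  by exists (invmx V *m delta_mx ord_max 0); rewrite mulKVmx.
exists (fun x => v (inord (index x (enum A))) 0) => j lejn.
rewrite -big_enum /= (big_nth 0) big_mkord sA.
have /matrixP/(_ (inord j) 0) := vE.
rewrite !mxE eqxx andbT -val_eqE /= inordK // => <-.
apply: eq_bigr => i _; rewrite !mxE inordK // mulrC; congr (_ * v _ 0).
by rewrite index_uniq ?enum_uniq ?sA // inord_val.
Qed.

(* The difference is the Catalan number [C(2m, m) / (m + 1)]. *)
Lemma catalan_coprime (p m : nat) : prime p -> (m.*2 < p)%N ->
  ~~ (p %| 'C(m.*2, m) - (if m is m'.+1 then 'C(m.*2, m') else 0))%N.
Proof.
move=> pr_p ltp.
have nfact n : (n < p)%N -> ~~ (p %| n`!)%N.
  elim: n => [|n IHn] ltn; first by rewrite Euclid_dvd1.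
  by rewrite factS Euclid_dvdM // negb_or gtnNdvd // IHn // ltnW.
have nbin : ~~ (p %| 'C(m.*2, m))%N.
  apply: contra (nfact _ ltp) => /(dvdn_mulr (m`! * (m.*2 - m)`!)).
  by rewrite bin_fact //; lia.
case: m ltp nbin => [|m] ltp nbin; first by rewrite subn0.
apply: contra nbin => /(dvdn_mull m.+2).
have E := mul_bin_left m.+1.*2 m.
have -> : (m.+2 * ('C(m.+1.*2, m.+1) - 'C(m.+1.*2, m)) = 'C(m.+1.*2, m.+1))%N.
  have d : (m.+1.*2 - m = m.+2)%N by lia.
  by move: E; rewrite d; nia.
by [].
Qed.

(** This is the bound 2|A| - 3 in the range where it does not exceed p. The parameter m = |A| - 2 is
    chosen so that 2m restricted sums would be the roots of a polynomial of degree 2m in a + b. *)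
Lemma erdos_heilbronn_finField (F : finFieldType) (p m : nat) (A : {set F}) :
  p \in [pchar F] -> (m.*2 < p)%N -> #|A| = m.+2 ->
  (m.*2 < #|restricted_sumset A|)%N.
Proof.
move=> pF ltp cA; rewrite ltnNge; apply/negP => leC.
have pr_p := pcharf_prime pF.
set C := restricted_sumset A in leC.
(* Dropping a point makes the degrees m + 1 and m differ. On A x A the relevant coefficient, that of
   a^(m+1) b^(m+1), would be zero because (a - b) P(a + b) is antisymmetric. *)
have [B sBA cB] : exists2 B : {set F}, B \subset A & #|B| = m.+1.
  have [x0 Ax0] : exists x0, x0 \in A by apply/set0Pn; rewrite -cards_eq0 cA.
  by exists (A :\ x0); rewrite ?subD1set //; move: cA;
    rewrite (cardsD1 x0) Ax0 => -[].
have [w wP] := exists_moment_weights cA.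
have [v vP] := exists_moment_weights cB.
pose P := (\prod_(c <- enum C) ('X - c%:P)) * 'X^(m.*2 - #|C|) : {poly F}.
have monP : P \is monic by rewrite monicMl ?monicXn ?monic_prod_XsubC.
have sP : size P = m.*2.+1.
  rewrite size_Mmonic ?monicXn ?monic_neq0 ?monic_prod_XsubC //.
  by rewrite size_prod_XsubC size_polyXn -cardE; lia.
have P0 a b : a \in A -> b \in A -> a != b -> P.[a + b] = 0.
  move=> Aa Ab nab; apply/eqP; rewrite -/(root _ _) rootM; apply/orP; left.
  by rewrite root_prod_XsubC mem_enum; apply/imset2P; exists a b; rewrite ?inE ?Ab.
(* [S] extracts the coefficient of a^(m+1) b^m; the polynomial (a - b) P(a + b)
   vanishes on A x B, although that coefficient is a Catalan number. Padding P
   to degree exactly 2m makes all its lower-degree terms invisible to [S]. *)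
pose S (G : F -> F -> F) := \sum_(a in A) \sum_(b in B) w a * v b * G a b.
have S0 : S (fun a b => (a - b) * P.[a + b]) = 0.
  rewrite /S big1 // => a Aa; rewrite big1 // => b /(subsetP sBA) Ab.
  have [->|nab] := eqVneq a b; first by rewrite subrr mul0r mulr0.
  by rewrite P0 // !mulr0.
(* If j > m + 1, the degree bound forces i < m and the sum over [B] vanishes; if j = m + 1, it
   forces i <= m, the range of [vP]. *)
have Smon j i : (j + i <= m.*2.+1)%N ->
    S (fun a b => a ^+ j * b ^+ i) = ((j == m.+1) && (i == m))%:R.
  move=> leij; have -> : S (fun a b => a ^+ j * b ^+ i) =
      (\sum_(a in A) w a * a ^+ j) * (\sum_(b in B) v b * b ^+ i).
    rewrite big_distrlr; apply: eq_bigr => a _; apply: eq_bigr => b _ /=; ring.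
  have [lej|gtj] := leqP j m.+1; last first.
    have lti : (i < m)%N by lia.
    by rewrite vP ?(ltnW lti) // (ltn_eqF lti) mulr0 andbF.
  rewrite wP // -mulnb natrM; have [ej|nj] := eqVneq j m.+1; last by rewrite !mul0r.
  by rewrite vP //; lia.
have SB G H : S (fun a b => G a b - H a b) = S G - S H.
  rewrite /S -sumrB; apply: eq_bigr => a _; rewrite -sumrB.
  by apply: eq_bigr => b _; rewrite mulrBr.
have Ssum (n : nat) (G : nat -> F -> F -> F) (c : nat -> F) :
    S (fun a b => \sum_(i < n) c i * G i a b) = \sum_(i < n) c i * S (G i).
  under [RHS]eq_bigr do rewrite big_distrr.
  rewrite exchange_big; apply: eq_bigr => a _ /=.
  under [RHS]eq_bigr do rewrite big_distrr.
  rewrite exchange_big; apply: eq_bigr => b _ /=; rewrite big_distrr.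
  by apply: eq_bigr => i _ /=; ring.
have eqS G H : (forall a b, G a b = H a b) -> S G = S H.
  by move=> eGH; apply: eq_bigr => a _; apply: eq_bigr => b _; rewrite eGH.
have Sbin j : (j <= m.*2)%N -> S (fun a b => (a - b) * (a + b) ^+ j) =
    \sum_(i < j.+1) 'C(j, i)%:R *
      ((((j - i).+1 == m.+1) && (i == m :> nat))%:R -
       ((j - i == m.+1)%N && (i.+1 == m))%:R).
  move=> lej.
  pose M i a b : F := a ^+ (j - i).+1 * b ^+ i - a ^+ (j - i) * b ^+ i.+1.
  rewrite (eqS _ (fun a b => \sum_(i < j.+1) 'C(j, i)%:R * M i a b)); last first.
    move=> a b; rewrite exprDn big_distrr; apply: eq_bigr => i _ /=.
    rewrite /M -mulr_natl !exprS; ring.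
  rewrite (Ssum j.+1 M (fun i => 'C(j, i)%:R)).
  apply: eq_bigr => i _; congr (_ * _).
  by rewrite SB !Smon //; have := ltn_ord i; lia.
have Slow j : (j < m.*2)%N -> S (fun a b => (a - b) * (a + b) ^+ j) = 0.
  move=> ltj; rewrite Sbin 1?ltnW // big1 // => i _; have := ltn_ord i => lti.
  rewrite [X in (nat_of_bool X)%:R - _](_ : _ = false); last by lia.
  rewrite [X in _ - (nat_of_bool X)%:R](_ : _ = false); last by lia.
  by rewrite subrr mulr0.
have Stop : S (fun a b => (a - b) * (a + b) ^+ m.*2) =
   ('C(m.*2, m) - (if m is m'.+1 then 'C(m.*2, m') else 0))%N%:R.
  have pick (c : nat -> F) k n : (k < n)%N ->
      \sum_(i < n) c i * (i == k :> nat)%:R = c k.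
    move=> ltk; under eq_bigr do rewrite mulr_natr mulrb.
    by rewrite -big_mkcond big_ord1_eq ltk.
  rewrite Sbin // natrB; last first.
    case: (m) => // m'; have := mul_bin_left m'.+1.*2 m'; nia.
  under eq_bigr do rewrite mulrBr.
  rewrite sumrB; congr (_ - _).
    rewrite -[RHS](pick (fun i => 'C(m.*2, i)%:R) m m.*2.+1); last by lia.
    apply: eq_bigr => i _; congr (_ * (nat_of_bool _)%:R).
    by have := ltn_ord i; lia.
  case: {Sbin Slow Smon cA cB wP vP ltp leC sP} (m) => [|m'].
    by rewrite big1 // => i _; rewrite andbF mulr0.
  rewrite -[RHS](pick (fun i => 'C(m'.+1.*2, i)%:R) m' m'.+1.*2.+1); last by lia.
  apply: eq_bigr => i _; congr (_ * (nat_of_bool _)%:R).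
  by have := ltn_ord i; lia.
(* Expand P in powers of a + b: only its leading coefficient 1 survives [S], so the Catalan number
   would vanish in [F]. *)
move/eqP: S0.
rewrite (eqS _ (fun a b =>
  \sum_(i < m.*2.+1) P`_i * ((a - b) * (a + b) ^+ i))); last first.
  by move=> a b; rewrite horner_coef sP big_distrr; apply: eq_bigr => i _ /=; ring.
rewrite (Ssum _ (fun i a b => (a - b) * (a + b) ^+ i) (fun i => P`_i)).
rewrite big_ord_recr /= big1 ?add0r => [|i _]; last by rewrite Slow ?mulr0.
have -> : P`_m.*2 = 1 by move/monicP: monP; rewrite lead_coefE sP.
by rewrite mul1r Stop -(dvdn_pcharf pF) (negPf (catalan_coprime pr_p ltp)).
Qed.

Local Close Scope ring_scope.

(** * Cauchy-Davenport in finite abelian groups *)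

Local Open Scope group_scope.

(** Induction on |B|: a Dyson transform shrinks B, preserves |A| + |B| and does not enlarge the
    product set. When none applies, A is stable under right translation by b0^-1 B, which forces |A|
    >= [pdiv #|G|] unless B is a singleton. *)
Lemma cauchy_davenport (gT : finGroupType) (G : {group gT})
    (A B : {set gT}) :
  abelian G ->
  A \subset G -> B \subset G -> A != set0 -> B != set0 ->
  minn (pdiv #|G|) (#|A| + #|B|).-1 <= #|A * B|.
Proof.
move=> abG; have [N leBN] := ubnP #|B|.
elim: N => // N IHN in A B leBN * => sAG sBG A0 B0.
have /set0Pn[b0 Bb0] := B0; have Gb0 := subsetP sBG _ Bb0.
have mulGC x y : x \in G -> y \in G -> x * y = y * x.
  by move=> Gx Gy; apply: (centsP abG).
have [/existsP[e /andP[Ae /existsP[b /andP[Bb nAb]]]]|] :=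
  boolP [exists e in A, exists b in B, e * b0^-1 * b \notin A].
  (* Dyson transform of (A, B) by t; it keeps b0 in B and loses b. *)
  pose t := e * b0^-1.
  have Gt : t \in G by rewrite groupM ?groupV // (subsetP sAG).
  pose A' := A :|: t *: B; pose B' := B :&: t^-1 *: A.
  have cardAB : (#|A'| + #|B'| = #|A| + #|B|)%N.
    have -> : #|B'| = #|A :&: t *: B|.
      rewrite -(card_lcoset B' t); congr #|pred_of_set _|; apply/setP => x.
      by rewrite !(mem_lcoset, inE) invgK mulKVg andbC.
    by rewrite cardsUI card_lcoset.
  have Bb0' : b0 \in B' by rewrite inE Bb0 mem_lcoset invgK mulgKV.
  have ltB : #|B'| < #|B|.
    apply: proper_card; rewrite properE subsetIl; apply/subsetPn; exists b => //.
    by rewrite inE Bb mem_lcoset invgK.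
  have sB'G : B' \subset G by rewrite subIset ?sBG.
  have sA'G : A' \subset G.
    by rewrite subUset sAG; apply/subsetP => _ /lcosetP[y By ->];
      rewrite groupM // (subsetP sBG).
  rewrite -cardAB; apply: leq_trans (IHN A' B' _ sA'G sB'G _ _) _.
  - by rewrite (leq_trans ltB).
  - by apply/set0Pn; exists e; rewrite inE Ae.
  - by apply/set0Pn; exists b0.
  apply/subset_leq_card/subsetP => _ /mulsgP[x y + + ->].
  rewrite !inE => Ax /andP[By Ay].
  case/orP: Ax => [Ax|/lcosetP[z Bz ->]]; first exact: mem_mulg.
  rewrite mem_lcoset invgK in Ay; have Gz := subsetP sBG _ Bz.
  have Gy := subsetP sBG _ By.
  by rewrite -mulgA (mulGC z) // mulgA mem_mulg.
rewrite negb_exists => /forallP stabA.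
have {}stabA e b : e \in A -> b \in B -> e * (b0^-1 * b) \in A.
  move=> Ae Bb; move: (stabA e); rewrite Ae negb_exists => /forallP /(_ b).
  by rewrite Bb negbK mulgA.
have leA : #|A| <= #|A * B|.
  rewrite -(card_rcoset A b0); apply: subset_leq_card.
  by rewrite mulgS ?sub1set.
have [|B1] := leqP #|B| 1.
  rewrite leq_eqVlt ltnS leqn0 cards_eq0 (negPf B0) orbF => /eqP ->.
  by rewrite addn1 geq_min leA orbT.
rewrite geq_min; apply/orP; left; apply: leq_trans leA.
have /set0Pn[b1] : B :\ b0 != set0.
  by rewrite -card_gt0; move: B1; rewrite (cardsD1 b0) Bb0.
rewrite !inE => /andP[nb Bb1]; pose x := b0^-1 * b1.
have Gx : x \in G by rewrite groupM ?groupV // (subsetP sBG).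
have x1 : 1 < #[x] by rewrite order_gt1 /x -eq_mulVg1 eq_sym.
(* A is now stable under b0^-1 B, hence contains a coset of a nontrivial
   cyclic group. *)
have /set0Pn[a Aa] := A0.
have sxA : a *: <[x]> \subset A.
  apply/subsetP => _ /lcosetP[_ /cycleP[i ->] ->].
  by elim: i => [|i IHi]; rewrite ?mulg1 // expgSr mulgA stabA.
apply: leq_trans (subset_leq_card sxA); rewrite card_lcoset.
by rewrite pdiv_min_dvd // order_dvdG.
Qed.

(** * Restricted product sets *)

Definition restricted_mulset (gT : finGroupType) (A : {set gT}) : {set gT} :=
  [set (a * b)%g | a in A, b in A & a != b].

Lemma mem_restricted_mulset (gT : finGroupType) (A : {set gT}) (a b : gT) :
  a \in A -> b \in A -> a != b -> a * b \in restricted_mulset A.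
Proof. by move=> Aa Ab nab; apply/imset2P; exists a b; rewrite ?inE ?Ab. Qed.

Lemma restricted_mulsetP (gT : finGroupType) (A : {set gT}) (c : gT) :
  reflect (exists a b, [/\ a \in A, b \in A, a != b & c = a * b])
          (c \in restricted_mulset A).
Proof.
apply: (iffP imset2P) => [[a b Aa]|[a [b [Aa Ab nab ->]]]].
  by rewrite inE => /andP[Ab nab] ->; exists a, b.
by exists a b; rewrite ?inE ?Ab.
Qed.

Lemma restricted_mulsetS (gT : finGroupType) (A B : {set gT}) :
  A \subset B -> restricted_mulset A \subset restricted_mulset B.
Proof.
move=> /subsetP sAB; apply/subsetP => _ /restricted_mulsetP[a [b [Aa Ab nab ->]]].
by rewrite mem_restricted_mulset ?sAB.
Qed.

(** Distinct images have distinct preimages, so [h] maps onto the left-hand set. Keeping [h] apart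
    from [f] covers translations, where [h] translates twice, as well as morphisms. *)
Lemma card_restricted_mulset_imset (aT rT : finGroupType) (f h : aT -> rT)
    (A : {set aT}) :
  {in A &, forall a b, f a * f b = h (a * b)} ->
  #|restricted_mulset (f @: A)| <= #|restricted_mulset A|.
Proof.
move=> fM; apply: leq_trans (leq_imset_card h _); apply/subset_leq_card/subsetP.
move=> _ /restricted_mulsetP[_ [_ [/imsetP[a Aa ->] /imsetP[b Ab ->] nab ->]]].
rewrite fM // imset_f // mem_restricted_mulset //.
by apply: contraNneq nab => ->.
Qed.

(** The group law of a finite Z-module is its addition by conversion; this lets subgroups and
    quotients serve the additive problem. *)
Lemma restricted_mulset_Zmod (T : finZmodType) (A : {set T}) :
  restricted_mulset A = restricted_sumset A.
Proof. by []. Qed.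

(** * Restricted products in groups of prime order, then in abelian groups *)

Lemma exists_subset_card (T : finType) (A : {set T}) (m : nat) :
  m <= #|A| -> exists2 B : {set T}, B \subset A & #|B| = m.
Proof.
move=> lem; exists [set x in take m (enum A)].
  by apply/subsetP => x; rewrite inE => /mem_take; rewrite mem_enum.
rewrite cardsE (card_uniqP _) ?take_uniq ?enum_uniq //.
by rewrite size_takel // -cardE.
Qed.

(** The exponent map z |-> x^z from ['F_p], for a generator x, carries the finite field bound over
    to G. *)
Lemma erdos_heilbronn_prime (gT : finGroupType) (G : {group gT})
    (A : {set gT}) :
  prime #|G| -> A \subset G ->
  (minn #|G| (2 * #|A| - 3) <= #|restricted_mulset A|)%N.
Proof.
move=> pr_G sAG; set p := #|G| in pr_G *.
wlog leAp : A sAG / (2 * #|A| - 3 <= p)%N.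
  move=> IH; have [|] := boolP (2 * #|A| - 3 <= p)%N; first exact: IH.
  rewrite -ltnNge => ltA.
  have [p2|p_odd] := even_prime pr_G.
    by have := subset_leq_card sAG; rewrite -/p p2; lia.
  (* For odd p this size gives 2|B| - 3 = p exactly. *)
  have [|B sBA cB] := @exists_subset_card gT A (p.+3)./2; first by lia.
  apply: leq_trans (subset_leq_card (restricted_mulsetS sBA)).
  apply: leq_trans (IH B (subset_trans sBA sAG) _); rewrite cB; lia.
have [|gtA] := leqP #|A| 1; first by rewrite geq_min; lia.
have /cyclicP[x Gx] := prime_cyclic pr_G.
have ox : #[x] = p by rewrite /p Gx.
have ltZ (z : 'F_p) : z < p by rewrite -[X in _ < X](Fp_cast pr_G).
pose f (z : 'F_p) := x ^+ z.
have fM (z t : 'F_p) : f z * f t = f (z + t)%R.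
  rewrite /f.
  have -> : (z + t)%R = (z + t) %% p :> nat by congr modn; apply: Fp_cast.
  by rewrite -expgD -[LHS]expg_mod_order ox.
have f_inj : injective f.
  move=> z t /eqP; rewrite eq_expg_mod_order ox => /eqP.
  by rewrite !modn_small // => /val_inj.
pose B : {set 'F_p} := f @^-1: A.
have fB : f @: B = A.
  apply/setP => y; apply/imsetP/idP => [[z]|Ay]; first by rewrite inE => ? ->.
  have := subsetP sAG _ Ay; rewrite Gx => /cyclePmin[i]; rewrite ox => lti yE.
  have fi : f i%:R%R = y by rewrite /f val_Fp_nat // modn_small.
  by exists i%:R%R; rewrite // inE fi.
have cB : #|B| = (#|A| - 2).+2 by rewrite -(card_imset _ f_inj) fB -addn2 subnK.
rewrite geq_min; apply/orP; right.
have sf : f @: restricted_sumset B \subset restricted_mulset A.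
  apply/subsetP => _ /imsetP[_ /imset2P[a b + + ->] ->].
  rewrite !inE => Ba /andP[Bb nab]; rewrite -fM mem_restricted_mulset //.
  by apply: contra nab => /eqP/f_inj ->.
apply: leq_trans (subset_leq_card sf); rewrite card_imset //.
have lt : ((#|A| - 2).*2 < p)%N by lia.
apply: leq_trans (erdos_heilbronn_finField (pchar_Fp pr_G) lt cB).
by lia.
Qed.

Theorem erdos_heilbronn_abelian (gT : finGroupType) (G : {group gT})
    (A : {set gT}) :
  abelian G -> A \subset G ->
  (minn (pdiv #|G|) (2 * #|A| - 3) <= #|restricted_mulset A|)%N.
Proof.
have [N] := ubnP #|G|.
elim: N => // N IHN in gT G A * => leGN abG sAG; set p := pdiv #|G|.
have [|gtA] := leqP #|A| 1; first by rewrite geq_min; lia.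
(* The bound is p + 4 rather than p + 3 because of p = 2, where three elements are needed for 2|A| -
   3 to reach p. *)
wlog leAp : A sAG gtA / (2 * #|A| <= p + 4)%N.
  move=> IH; have [|] := boolP (2 * #|A| <= p + 4)%N; first exact: IH.
  rewrite -ltnNge => ltA.
  have [|B sBA cB] := @exists_subset_card gT A (p./2 + 2); first by lia.
  apply: leq_trans (subset_leq_card (restricted_mulsetS sBA)).
  by apply: leq_trans (IH B (subset_trans sBA sAG) _ _); rewrite cB; lia.
have gtG : (1 < #|G|)%N by apply: leq_trans gtA (subset_leq_card sAG).
have pr_p : prime p := pdiv_prime gtG.
have [x Gx ox] := Cauchy pr_p (pdiv_dvd _).
pose H := <[x]>%G.
have cH : #|H| = p := ox.
have sHG : H \subset G by rewrite cycle_subG.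
have nHG : G \subset 'N(H) := sub_abelian_norm abG sHG.
have abQ : abelian (G / H) := quotient_abelian _ abG.
have cQ : (#|G / H| < #|G|)%N by rewrite ltn_quotient // -cardG_gt1 cH prime_gt1.
have lepQ : (1 < #|G / H|)%N -> (p <= pdiv #|G / H|)%N.
  by move=> Q1; rewrite pdiv_min_dvd ?pdiv_prime // ?prime_gt1 ?pdiv_prime //
    (dvdn_trans (pdiv_dvd _)) ?dvdn_quotient.
pose phi := coset H.
have phiM : {in G &, {morph phi : a b / a * b}}.
  by move=> a b Ga Gb; rewrite /phi morphM // (subsetP nHG).
have GA a : a \in A -> a \in G := subsetP sAG a.
pose X := phi @: A.
have sXQ : X \subset G / H.
  by apply/subsetP => _ /imsetP[a Aa ->]; rewrite mem_quotient ?GA.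
pose fib (T : {set gT}) (y : coset_of H) := [set a in T | phi a == y].
pose R := restricted_mulset A.
have sumA : (\sum_(y in X) #|fib A y| = #|A|)%N.
  rewrite -[RHS]sum1_card (partition_big_imset phi) /=.
  by apply: eq_bigr => y _; rewrite -sum1_card; apply: eq_bigl => a; rewrite inE.
have sumR (Y : {set coset_of H}) : (\sum_(y in Y) #|fib R y| <= #|R|)%N.
  rewrite -[leqRHS]sum1_card (partition_big phi predT) //=.
  rewrite [leqRHS](bigID (mem Y)) /=; apply: leq_trans (leq_addr _ _).
  apply: leq_sum => y _; rewrite -sum1_card; apply/eq_leq/eq_bigl => a.
  by rewrite inE.
have fib_gt0 (y : coset_of H) : y \in X -> (0 < #|fib A y|)%N.
  by case/imsetP => a Aa ->; apply/card_gt0P; exists a; rewrite inE Aa eqxx.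
(* Elements of distinct cosets differ, so all products of the two fibres are restricted. By [leAp],
   |A| - 1 <= p, so p is never the smaller term in Cauchy-Davenport. *)
have fib_prod (y z : coset_of H) : y \in X -> z \in X -> y != z ->
    (#|fib A y| + #|fib A z| - 1 <= #|fib R (y * z)%g|)%N.
  move=> Xy Xz nyz.
  have sfA t : fib A t \subset A by apply/subsetP => a; rewrite inE => /andP[].
  have := @cauchy_davenport _ G (fib A y) (fib A z) abG.
  rewrite !(subset_trans (sfA _)) // -!card_gt0 !fib_gt0 // => /(_ isT isT isT isT).
  have : (#|fib A y| + #|fib A z| <= #|A|)%N.
    rewrite -sumA (bigD1 y) //= leq_add2l (bigD1 z) ?leq_addr //=.
    by rewrite Xz eq_sym.
  have : (#|(fib A y * fib A z)%g| <= #|fib R (y * z)%g|)%N.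
    apply/subset_leq_card/subsetP => _ /mulsgP[a b + + ->].
    rewrite !inE => /andP[Aa /eqP ya] /andP[Ab /eqP zb].
    rewrite phiM ?GA // ya zb eqxx andbT mem_restricted_mulset //.
    by apply: contraNneq nyz => ab; rewrite -ya -zb ab.
  by rewrite -/p; move: leAp (prime_gt1 pr_p); clear; lia.
(* Translating the fibre by the inverse of one of its elements puts it inside H, where the prime
   case applies. *)
have fib_sqr (y : coset_of H) : y \in X ->
    (minn p (2 * #|fib A y| - 3) <= #|fib R (y * y)%g|)%N.
  case/imsetP => g Ag yE.
  pose B := [set b * g^-1 | b in fib A y].
  have sBH : B \subset H.
    apply/subsetP => _ /imsetP[b + ->]; rewrite !inE => /andP[Ab].
    rewrite yE => /eqP; rewrite /phi => /rcoset_kercosetP.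
    by rewrite mem_rcoset; apply; rewrite (subsetP nHG) ?GA.
  have cB : #|B| = #|fib A y| by rewrite card_imset //; apply: mulIg.
  rewrite -cB -cH; apply: leq_trans (erdos_heilbronn_prime _ sBH) _.
    by rewrite cH.
  apply: leq_trans (_ : (#|restricted_mulset (fib A y)| <= _)%N).
    apply: (card_restricted_mulset_imset (h := fun c => c * g^-1 * g^-1)).
    move=> a b; rewrite !inE => /andP[Aa _] /andP[Ab _].
    rewrite !mulgA; congr (_ * _); rewrite -!mulgA; congr (_ * _).
    by apply: (centsP abG); rewrite ?groupV GA.
  apply/subset_leq_card/subsetP => _ /restricted_mulsetP[a [b [+ + nab ->]]].
  rewrite !inE => /andP[Aa /eqP ya] /andP[Ab /eqP zb].
  by rewrite phiM ?GA // ya zb eqxx andbT mem_restricted_mulset.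
have [x1 X1 max1] : exists2 x1, x1 \in X &
    forall y, y \in X -> (#|fib A y| <= #|fib A x1|)%N.
  have [a Aa] : exists a, a \in A by apply/card_gt0P; rewrite ltnW.
  have Xa : phi a \in X by apply: imset_f.
  by case: (arg_maxnP (fun y => #|fib A y|) Xa) => x1 X1 max1; exists x1.
set k := #|fib A x1| in max1.
have [s1|s_gt1] := leqP #|X| 1.
  have XE : X = [set x1].
    by apply/eqP; rewrite eq_sym eqEcard sub1set X1 cards1.
  have kA : k = #|A| by rewrite -sumA XE big_set1.
  apply: leq_trans (sumR [set x1 * x1]); rewrite big_set1 -kA.
  exact: fib_sqr.
have gtQ : (1 < #|G / H|)%N by apply: leq_trans s_gt1 (subset_leq_card sXQ).
have [k1|k_gt1] := leqP k 1.
  have cX : #|X| = #|A|.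
    rewrite -sumA -[LHS]sum1_card; apply: eq_bigr => y Xy.
    by apply/eqP; rewrite eqn_leq fib_gt0 //= (leq_trans (max1 y Xy)).
  apply: leq_trans (_ : (#|restricted_mulset X| <= _)%N); last first.
    apply: (card_restricted_mulset_imset (h := phi)) => a b Aa Ab.
    by rewrite phiM ?GA.
  apply: leq_trans (IHN _ (G / H)%G X _ abQ sXQ); last by rewrite (leq_trans cQ).
  by rewrite cX leq_min geq_min (lepQ gtQ) geq_minr.
(* Products with the largest fibre are counted in full; every other class of
   X * X has at least one element, unless it is only the square of a class with
   a singleton fibre. *)
pose Y1 := [set x1 * z | z in X].
pose Y2 := (X * X) :\: Y1.
pose U := [set z in X | #|fib A z| == 1%N].
(* The square of [x1] contributes 2k - 3, and each other z in X contributes k - 1 plus the size of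
   its fibre. *)
have sum1 : (2 * k - 3 + (#|X| - 1) * (k - 1) + (#|A| - k) <=
    \sum_(y in Y1) #|fib R y|)%N.
  rewrite big_imset /=; last by move=> y z _ _; apply: mulgI.
  rewrite (bigD1 x1) //= -addnA leq_add //.
    apply: leq_trans (fib_sqr _ X1); rewrite leq_min leqnn andbT.
    (* A second coset makes k <= |A| - 1, so 2k - 3 < p and the minimum in [fib_sqr] is 2k - 3. *)
    have : (k < #|A|)%N.
      rewrite -sumA (bigD1 x1) //= -[X in (X < _)%N]addn0 ltn_add2l.
      have [y Xy ny] : exists2 y, y \in X & y != x1.
        have /card_gt0P[y] : (0 < #|X :\ x1|)%N.
          by move: s_gt1; rewrite (cardsD1 x1) X1.
        by rewrite !inE => /andP[ny Xy]; exists y.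
      by rewrite (bigD1 y) ?Xy //= addn_gt0 fib_gt0.
    by move: leAp; clear; lia.
  have -> : (#|A| - k = \sum_(z in X | z != x1) #|fib A z|)%N.
    by rewrite -sumA (bigD1 x1) //= addKn.
  have -> : (#|X| - 1 = \sum_(z in X | z != x1) 1)%N.
    by rewrite -sum1_card (bigD1 x1) //= addKn.
  rewrite big_distrl -big_split; apply: leq_sum => z /andP[Xz nz] /=.
  apply: leq_trans (fib_prod _ _ X1 Xz _); last by rewrite eq_sym.
  by rewrite -/k mul1n addnBAC // ltnW.
have sum2 : (#|Y2| <= \sum_(y in Y2) #|fib R y| + #|U|)%N.
  pose Y3 := [set y in Y2 | 0 < #|fib R y|]%N.
  have sY2 : Y2 \subset Y3 :|: [set z * z | z in U].
    apply/subsetP => y Y2y; rewrite inE [y \in Y3]inE Y2y /=.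
    case: posnP => [/eqP|//]; rewrite cards_eq0 => /eqP Ry0 /=.
    move: Y2y; rewrite inE => /andP[_ /mulsgP[z t Xz Xt yE]].
    have ezt : z = t.
      apply/eqP; apply: contraT => nzt; have := fib_prod z t Xz Xt nzt.
      rewrite -yE Ry0 cards0; have := fib_gt0 z Xz; have := fib_gt0 t Xt.
      by clear; lia.
    apply/imsetP; exists z; rewrite ?yE -?ezt // inE Xz.
    have := fib_sqr z Xz; rewrite {3}ezt -yE Ry0 cards0.
    by have := fib_gt0 z Xz; have := prime_gt1 pr_p; clear; lia.
  apply: leq_trans (subset_leq_card sY2) _.
  apply: leq_trans (leq_card_setU _ _) _; rewrite leq_add ?leq_imset_card //.
  rewrite -sum1_card big_mkcond [leqRHS]big_mkcond; apply: leq_sum => y _.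
  by rewrite inE; case: (y \in Y2); case: posnP.
have sum12 : (\sum_(y in Y1) #|fib R y| + \sum_(y in Y2) #|fib R y| <= #|R|)%N.
  apply: leq_trans (sumR (Y1 :|: Y2)); rewrite [leqRHS](big_setID Y1) /= setUK.
  rewrite (_ : (Y1 :|: Y2) :\: Y1 = Y2) //; apply/setP => y.
  by rewrite !in_setD in_setU in_setD; case: (y \in Y1).
(* Cauchy-Davenport in G / H, whose least prime divisor is at least p, less the |X| classes of
   [Y1]. *)
have cY2 : (minn p (2 * #|X| - 1) - #|X| <= #|Y2|)%N.
  have := @cauchy_davenport _ (G / H)%G X X abQ sXQ sXQ.
  have X0 : X != set0 by apply/set0Pn; exists x1.
  move=> /(_ X0 X0); have cY1 : #|Y1| = #|X| by rewrite card_imset //; apply: mulgI.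
  have := cardsD (X * X) Y1; have := subset_leq_card (subsetIr (X * X) Y1).
  rewrite cY1 -/Y2; have := lepQ gtQ; clear.
  move: #|pred_of_set (X * X)| #|pred_of_set (X * X :&: Y1)| => b c.
  by move: (pdiv #|pred_of_set (G / H)|) #|X| #|Y2| (p) => *; lia.
have leA : (#|A| <= #|U| + (#|X| - #|U|) * k)%N.
  have -> : (#|X| - #|U| = #|X :\: U|)%N.
    by rewrite cardsD (setIidPr _) //; apply/subsetP => y; rewrite inE => /andP[].
  rewrite -sumA (big_setID U) /=; apply: leq_add.
    rewrite -sum1_card (setIidPr _); last first.
      by apply/subsetP => y; rewrite inE => /andP[].
    by apply/eq_leq/eq_bigr => y; rewrite inE => /andP[_ /eqP].
  rewrite -sum1_card big_distrl; apply: leq_sum => y /setDP[Xy _] /=.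
  by rewrite mul1n max1.
have leU : (#|U| <= #|X|)%N.
  by apply/subset_leq_card/subsetP => y; rewrite inE => /andP[].
have lekA : (k <= #|A|)%N by rewrite -sumA (bigD1 x1) ?leq_addr.
rewrite -/R.
move: sum1 sum2 sum12 cY2 leA leU lekA s_gt1 k_gt1 leAp (prime_gt1 pr_p).
move: #|A| #|X| #|U| #|R| #|Y2| => a s u r y2.
move: (\sum_(y in Y1) _)%N (\sum_(y in Y2) _)%N => t1 t2.
clearbody k p; clear => sum1 sum2 sum12 cY2 leA leU lekA s_gt1 k_gt1 leAp p_gt1.
(* If 2s - 1 <= p, the bounds add up to r >= a + s k - u - 3, and [leA] gives a <= s k - u because k
   > 1. Shifting s and k by 2 clears truncated subtraction from the products, which [lia] then
   treats as atoms. *)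
have [s' sE] : exists s', s = s'.+2 by exists (s - 2)%N; lia.
have [k' kE] : exists k', k = k'.+2 by exists (k - 2)%N; lia.
have ksE : ((s - 1) * (k - 1) = s' * k' + s' + k' + 1)%N.
  by rewrite sE kE !subn1 /= mulSn mulnS; clear; lia.
have usE : ((s - u) * k = s' * k' + 2 * s' + 2 * k' + 4 - (u * k' + 2 * u))%N.
  rewrite mulnBl; congr (_ - _)%N; rewrite ?sE kE !mulnS ?mulSn; clear; lia.
move: sum1 leA; rewrite ksE usE; move: (s' * k')%N (u * k')%N => P Q sum1 leA.
by clear ksE usE; subst s k; lia.
Qed.

Local Close Scope group_scope.

(** * Upper bounds from explicit colorings *)

Lemma Phi_hat_le_block (n k m : nat) : (1 < n)%N -> (0 < m)%N -> (n <= m * k)%N ->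
  (Phi_hat k n <= 2 * m - 3)%N.
Proof.
move=> n_gt1 m_gt0 le_n.
have ltZ (x : 'Z_n) : (x < n)%N by rewrite -[X in (_ < X)%N](Zp_cast n_gt1).
have ltk (x : 'Z_n) : (x %/ m < k)%N.
  by rewrite ltn_divLR // mulnC (leq_trans (ltZ x)).
apply: leq_trans (Phi_hat_le [ffun x => Ordinal (ltk x)]) _.
apply/bigmax_leqP => i _.
(* Two distinct integers in [i m, i m + m - 1] have a sum between 2 i m + 1 and 2 i m + 2m - 3. *)
pose sums := [seq (s%:R : 'Z_n)%R | s <- iota (2 * (i * m) + 1) (2 * m - 3)].
apply: leq_trans (_ : #|sums| <= _)%N; last first.
  by apply: leq_trans (card_size _) _; rewrite size_map size_iota.
apply/subset_leq_card/subsetP => _ /imset2P[a b + + ->].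
rewrite !inE !ffunE -!val_eqE /= => /eqP ai /andP[/eqP bi nab].
apply/mapP; exists (a + b)%N; last by rewrite natrD !natr_Zp.
have := divn_eq a m; have := divn_eq b m; rewrite ai bi mem_iota.
have := ltn_pmod a m_gt0; have := ltn_pmod b m_gt0.
by move: (i * m)%N => im; lia.
Qed.

(** A color class and its sums each lie in one residue class modulo q, which has n / q elements. The
    small values of [f] reflect that a singleton has no restricted sum and a pair has one. *)
Lemma Phi_hat_le_residue (n k q : nat) : (1 < n)%N -> (q %| n)%N ->
  (0 < q <= k)%N -> (Phi_hat k n <= f (n %/ q))%N.
Proof.
move=> n_gt1 q_n /andP[q_gt0 leqk].
have ltZ (x : 'Z_n) : (x < n)%N by rewrite -[X in (_ < X)%N](Zp_cast n_gt1).
have ltk (x : 'Z_n) : (x %% q < k)%N by rewrite (leq_trans _ leqk) ?ltn_pmod.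
apply: leq_trans (Phi_hat_le [ffun x => Ordinal (ltk x)]) _.
apply/bigmax_leqP => i _; set A := color_class _ _.
have modA a : a \in A -> a = i %[mod q].
  by rewrite !inE ffunE -val_eqE /= => /eqP <-; rewrite modn_mod.
have card_residue (r : nat) (B : {set 'Z_n}) :
    {in B, forall a : 'Z_n, a = r %[mod q]} -> (#|B| <= n %/ q)%N.
  move=> Br; have ltq (x : 'Z_n) : (x %/ q < n %/ q)%N.
    by rewrite ltn_divLR // divnK.
  rewrite -[X in (_ <= X)%N]card_ord.
  rewrite -(@card_in_imset _ _ (fun x => Ordinal (ltq x))) ?max_card //.
  move=> x y Bx By [exy]; apply: val_inj => /=.
  by rewrite (divn_eq x q) (divn_eq y q) exy (Br x Bx) (Br y By).
have cA := card_residue i A modA.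
have cS : (#|restricted_sumset A| <= n %/ q)%N.
  apply: (card_residue (2 * i)) => _ /imset2P[a b Aa + ->].
  rewrite inE => /andP[Ab _] /=.
  rewrite modn_dvdm; last by rewrite Zp_cast.
  rewrite -modnDm (modA a) // (modA b) // modnDm.
  by rewrite mul2n addnn.
have [t_gt2|t_le2] := ltnP 2 (n %/ q).
  by move: cS t_gt2; case: (n %/ q)%N => [|[|[|t]]].
have [leA|] := leqP #|A| 1.
  rewrite (_ : restricted_sumset A = set0) ?cards0 //.
  apply/eqP; rewrite -subset0; apply/subsetP => _ /imset2P[a b Aa + ->].
  rewrite inE => /andP[Ab /eqP[]].
  exact: (card_le1_eqP leA).
move=> gtA; have tE : (n %/ q)%N = 2.
  by apply/eqP; rewrite eqn_leq t_le2 (leq_trans gtA cA).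
have /cards2P[x [y [nxy AE]]] : #|A| == 2 by rewrite eqn_leq gtA -tE cA.
rewrite tE /= -(cards1 (x + y)%R); apply/subset_leq_card/subsetP.
move=> _ /imset2P[a b + + ->].
rewrite [in X in _ -> X]inE AE !inE => /orP[] /eqP-> /andP[/orP[] /eqP->];
  rewrite ?eqxx //.
by rewrite addrC.
Qed.

Lemma largest_divisor_leP (n k : nat) : (0 < n)%N -> (0 < k)%N ->
  (largest_divisor_le n k %| n)%N /\ (0 < largest_divisor_le n k <= k)%N.
Proof.
move=> n_gt0 k_gt0; rewrite /largest_divisor_le; set q := \max_(d <- _ | _) d.
have q_gt0 : (0 < q)%N.
  by apply: (leq_bigmax_seq (F := id) 1%N); rewrite // -dvdn_divisors ?dvd1n.
(* The disjunct q = 0 accounts for the neutral element of the maximum. *)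
have : (q == 0) || (q %| n) && (q <= k).
  rewrite /q big_seq_cond; elim/big_ind: _ => // [x y Px Py|d].
    by case: (leqP x y).
  by rewrite -dvdn_divisors // => /andP[-> ->]; rewrite orbT.
by rewrite eqn0Ngt q_gt0 /= => /andP[-> ->].
Qed.

(** * Lower bound and conclusion *)

Lemma Phi_hat_ge (n k m : nat) : (1 < n)%N -> (0 < k)%N -> (m.-1 * k < n)%N ->
  (minn (pdiv n) (2 * m - 3) <= Phi_hat k n)%N.
Proof.
move=> n_gt1 k_gt0 ltn; have [c ->] := Phi_hat_attained n k_gt0.
have cardZ : #|'Z_n| = n by rewrite card_ord Zp_cast.
(* Pigeonhole: classes of at most m - 1 elements would cover at most (m - 1) k < n points. *)
have [i lei] : exists i, (m <= #|color_class c i|)%N.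
  apply/existsP; apply: contraLR ltn; rewrite negb_exists -leqNgt => /forallP ltA.
  rewrite -{1}cardZ -sum1_card (partition_big c predT) //= mulnC.
  rewrite -[X in (_ <= X * _)%N]card_ord -sum_nat_const; apply: leq_sum => i _.
  have := ltA i; rewrite -ltnNge => ltAi.
  by rewrite sum1dep_card -ltnS (leq_trans ltAi) ?leqSpred.
apply: leq_trans (leq_bigmax i); set A := color_class c i in lei *.
have abZ := FinRing.zmod_abelian [set: 'Z_n]%g.
have := @erdos_heilbronn_abelian 'Z_n [set: 'Z_n]%G A abZ (subsetT _).
rewrite cardsT cardZ restricted_mulset_Zmod; apply: leq_trans.
by rewrite leq_min geq_minl geq_min orbC leq_sub2r // leq_mul2l.
Qed.

Local Open Scope ring_scope.
Unset Implicit Arguments.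
Set Strict Implicit.

Theorem theorem3 (n k : nat) (hn : (2 <= n)%N) (hk : (2 <= k)%N) :
  let m : int := Num.ceil (n%:R / k%:R : rat) in
  Num.max 0 (Num.min (pdiv n)%:Z (2 * m - 3)) <= (Phi_hat k n)%:Z /\
  (Phi_hat k n)%:Z <=
    Num.min (Num.max 0 (2 * m - 3)) (f (n %/ largest_divisor_le n k)%N)%:Z.
Proof.
move=> m; have k_gt0 : (0 < k)%N by apply: ltnW.
have kQ : 0 < k%:R :> rat by rewrite ltr0n.
(* The ceiling is used only through m > 0 and (m - 1) k < n <= m k, which allows a return to natural
   numbers. Truncated subtraction then plays the role of the maximum with 0. *)
have /andP[] := ceil_itv (n%:R / k%:R : rat); rewrite -/m.
have : 0 < m by rewrite /m ceil_gt0 divr_gt0 // ltr0n ltnW.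
clearbody m; case: m => [[|m]|m] // _; rewrite ltr_pdivlMr // ler_pdivrMr //.
rewrite (_ : m.+1%:Z - 1 = m%:Z); last by lia.
rewrite -!pmulrn -!natrM ltr_nat ler_nat => lt_n le_n.
have lower := @Phi_hat_ge n k m.+1 hn k_gt0 lt_n.
have upper1 := @Phi_hat_le_block n k m.+1 hn isT le_n.
have [q_n q_k] := largest_divisor_leP (ltnW hn) k_gt0.
have upper2 := Phi_hat_le_residue hn q_n q_k.
by rewrite le_min; split; lia.
Qed.
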